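(* If $A,B\in\mathcal{G}(\sigma,d)$ are adjacent, then they are $(i,j)$-adjacent for some distinct $i,j\in\{1,\dots,k\}$.
   Context: Let $H$ be a complex Hilbert space. Let $\sigma=\{a_1,\dots,a_k\}$, where $k\ge 2$ and $a_1,\dots,a_k$ are mutually distinct real numbers, and $d=\{n_1,\dots,n_k\}$, where $n_1,\dots,n_k\in\mathbb{N}\cup\{\infty\}$ are positive and not necessarily distinct ($n_i$ is attached to $a_i$); only an $n_i$ with $a_i=0$ may be $\infty$; $\dim H=n_1+\dots+n_k$. The $(\sigma,d)$-Grassmannian $\mathcal{G}(\sigma,d)$ is the set (a unitary conjugacy class) of all finite-rank self-adjoint operators on $H$ whose spectrum is $\sigma$ and such that for every $i$ the eigenspace corresponding to $a_i$ has dimension $n_i$. Operators $A,B\in\mathcal{G}(\sigma,d)$ are adjacent if (A1) the rank of $B-A$ is equal to $2$, and (A2) $\mathrm{Im}(B-A)$ and $\mathrm{Ker}(B-A)$ are invariant to both $A$ and $B$. Two closed subspaces $X,Y$ of the same dimension are adjacent if $X\cap Y$ is a hyperplane (subspace of codimension $1$) in both $X$ and $Y$. For distinct $i,j\in\{1,\dots,k\}$, operators $A,B\in\mathcal{G}(\sigma,d)$ with eigenspaces $X_t,Y_t$ (respectively) corresponding to $a_t$ are $(i,j)$-adjacent if $X_t,Y_t$ are adjacent for $t\in\{i,j\}$ and $X_t=Y_t$ for $t\notin\{i,j\}$. *)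

(* Defs.v *)
From HB Require Import structures.
From mathcomp Require Import all_boot all_order all_algebra.
From mathcomp Require Import complex.
From mathcomp Require Import all_classical all_reals all_analysis.

Set Implicit Arguments.
Unset Strict Implicit.
Unset Printing Implicit Defensive.

Import Order.TTheory GRing.Theory Num.Theory.
Import numFieldNormedType.Exports.

Local Open Scope classical_set_scope.
Local Open Scope ring_scope.
Local Open Scope complex_scope.

(* Elements of N u {oo}; [None] stands for oo. *)
Definition natbar := option nat.

Definition add_natbar (m n : natbar) : natbar :=
  if m is Some m' then (if n is Some n' then Some (m' + n')%N else None)
  else None.

Section LinearAlgebra.
Variables (K : fieldType) (V : lmodType K).
Implicit Types (X Z : set V).

Definition subspace X : Prop :=
  X 0 /\ forall (c : K) (x y : V), X x -> X y -> X (c *: x + y).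

Definition lin_indep (n : nat) (e : 'I_n -> V) : Prop :=
  forall c : 'I_n -> K, \sum_(i < n) c i *: e i = 0 -> forall i, c i = 0.

Definition lin_span (n : nat) (e : 'I_n -> V) : set V :=
  [set x | exists c : 'I_n -> K, x = \sum_(i < n) c i *: e i].

Definition fin_dim X (n : nat) : Prop :=
  exists e : 'I_n -> V, lin_indep e /\ X = lin_span e.

(* All infinite dimensions are identified, as n_i ranges over N u {oo}. *)
Definition has_dim X (n : natbar) : Prop :=
  if n is Some m then fin_dim X m
  else subspace X /\ forall m, ~ fin_dim X m.

(* [Z] is a subspace of [X] with dim (X / Z) = 1; the class of [v] spans the
   quotient. *)
Definition hyperplane_in Z X : Prop :=
  [/\ subspace Z, Z `<=` X &
      exists2 v : V, X v /\ ~ Z v &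
        forall x, X x -> exists2 z, Z z & exists c : K, x = z + c *: v].

End LinearAlgebra.

Section Operators.
Variables (R : realType) (H : completeNormedModType R[i]).
Implicit Types (A B : {linear H -> H}) (X Y : set H).

(* [ip] is linear in its first argument. Together with the completeness of [H]
   this makes [H] a complex Hilbert space. *)
Definition norm_from_inner (ip : {dot H for (@Num.conj R[i])}) : Prop :=
  forall x : H, `|x| ^+ 2 = ip x x.

Definition self_adjoint (ip : {dot H for (@Num.conj R[i])}) A : Prop :=
  forall x y : H, ip (A x) y = ip x (A y).

Definition finite_rank A : Prop := exists n : nat, fin_dim (range A) n.

(* The complement of the set of those [l] for which [A - l] is invertible in
   the algebra of bounded operators. *)
Definition spectrum A : set R[i] :=
  [set l | ~ exists S : {linear H -> H},
       [/\ continuous S,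
           forall x, S (A x - l *: x) = x &
           forall x, A (S x) - l *: S x = x]].

Definition eigenspace_of A (l : R) : set H := [set x | A x = l%:C *: x].

Definition op_ker A B : set H := [set x | (B \- A) x = 0].

Definition op_im A B : set H := range (B \- A).

Definition invariant A X : Prop := A @` X `<=` X.

Definition grassmannian (ip : {dot H for (@Num.conj R[i])}) (k : nat)
    (a : 'I_k -> R) (d : 'I_k -> natbar) : set {linear H -> H} :=
  [set A : {linear H -> H} |
           [/\ continuous A, finite_rank A, self_adjoint ip A,
               spectrum A = range (fun i => (a i)%:C) &
               forall i, has_dim (eigenspace_of A (a i)) (d i)]].

Definition op_adjacent A B : Prop :=
  fin_dim (op_im A B) 2 /\
  [/\ invariant A (op_im A B), invariant B (op_im A B),
      invariant A (op_ker A B) & invariant B (op_ker A B)].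

Definition subspace_adjacent X Y : Prop :=
  [/\ subspace X /\ closed X, subspace Y /\ closed Y,
      exists n, has_dim X n /\ has_dim Y n,
      hyperplane_in (X `&` Y) X & hyperplane_in (X `&` Y) Y].

Definition ij_adjacent (k : nat) (a : 'I_k -> R) (i j : 'I_k) A B : Prop :=
  (forall t, t \in [:: i; j] ->
     subspace_adjacent (eigenspace_of A (a t)) (eigenspace_of B (a t))) /\
  (forall t, t \notin [:: i; j] ->
     eigenspace_of A (a t) = eigenspace_of B (a t)).

End Operators.

(* Main.v *)
(* Put T = B - A. As T is self-adjoint, Ker T is the orthogonal complement of the
   plane Im T. Both A and B preserve this plane, so each has an orthogonal
   eigenbasis in it, with eigenvalues among the a_t. An eigenvector of A for an
   eigenvalue that does not occur on the plane is orthogonal to it, hence lies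
   in Ker T, where A = B. So if a_t is an eigenvalue on the plane for A but not
   for B, then the a_t-eigenspace of B is strictly contained in that of A,
   which is impossible if n_t is finite; and at most one n_t is infinite. As T
   is injective on the plane, neither operator is scalar there. It follows that
   A and B have the same two distinct eigenvalues a_i, a_j on the plane, and
   the corresponding eigenspaces of A and B differ only by the choice of a line
   in the plane. *)

Require Import Defs.
From HB Require Import structures.
From mathcomp Require Import all_boot all_order all_algebra.
From mathcomp Require Import complex.
From mathcomp Require Import all_classical all_reals all_analysis.
Import Order.TTheory GRing.Theory Num.Theory.
Import numFieldNormedType.Exports.
Local Open Scope classical_set_scope.
Local Open Scope ring_scope.
Local Open Scope complex_scope.

Set Implicit Arguments.
Unset Strict Implicit.
Unset Printing Implicit Defensive.

(** * Linear independence, dimension and eigenvectors in finite dimension *)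

Lemma lin_span_mem (K : fieldType) (V : lmodType K) (n : nat) (e : 'I_n -> V)
    (i : 'I_n) :
  lin_span e (e i).
Proof.
exists (fun j => (j == i)%:R); rewrite (bigD1 i) //= eqxx scale1r big1 ?addr0 //.
by move=> j /negPf->; rewrite scale0r.
Qed.

Lemma fin_dim_subspace (K : fieldType) (V : lmodType K) (X : set V) (n : nat) :
  fin_dim X n -> Defs.subspace X.
Proof.
move=> [e [_ ->]]; split.
  by exists (fun=> 0); rewrite big1 // => i _; rewrite scale0r.
move=> c _ _ [u ->] [v ->]; exists (fun i => c * u i + v i).
rewrite scaler_sumr -big_split; apply: eq_bigr => i _.
by rewrite scalerDl scalerA.
Qed.

(** Let [M] hold the coefficients of the [e i] over [f]. A row vector killed by [M] is a linear
    relation between the [e i], so the rows of [M] are free and its rank is [n], which is at most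
    [m]. *)
Lemma lin_indep_leq (K : fieldType) (V : lmodType K) (n m : nat)
    (e : 'I_n -> V) (f : 'I_m -> V) :
  lin_indep e -> (forall i, lin_span f (e i)) -> (n <= m)%N.
Proof.
move=> e_free ef; have [C eC] := choice ef; pose M := \matrix_(i < n, j < m) C i j.
suff /eqP <- : row_free M by exact: rank_leq_col.
apply: inj_row_free => u uM0; apply/rowP => i; rewrite mxE.
apply: (e_free (u 0)).
transitivity (\sum_j (u *m M) 0 j *: f j); last first.
  by rewrite uM0 big1 // => j _; rewrite mxE scale0r.
transitivity (\sum_i \sum_j (u 0 i * C i j) *: f j).
  apply: eq_bigr => l _; rewrite eC scaler_sumr.
  by apply: eq_bigr => j _; rewrite scalerA.
rewrite exchange_big; apply: eq_bigr => j _; rewrite mxE scaler_suml.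
by apply: eq_bigr => l _; rewrite mxE.
Qed.

(** A vector of [X] outside [Y], put in front of a basis of [Y], would give [n.+1] independent
    vectors in a span of [n] vectors. *)
Lemma fin_dim_subset_eq (K : fieldType) (V : lmodType K) (X Y : set V)
    (n : nat) :
  fin_dim X n -> fin_dim Y n -> Y `<=` X -> Y = X.
Proof.
move=> [f [_ eX]] [e [e_free eY]] YX; apply/seteqP; split=> // x Xx.
apply: contrapT => nYx.
pose e' (i : 'I_n.+1) := if unlift ord0 i is Some j then e j else x.
suff e'_free : lin_indep e'.
  suff : (n.+1 <= n)%N by rewrite ltnn.
  apply: (lin_indep_leq (f := f) e'_free) => i; rewrite -eX /e'.
  by case: unliftP => [j _|_] //; apply: YX; rewrite eY; exact: lin_span_mem.
move=> c; rewrite big_ord_recl /e' unlift_none.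
under eq_bigr do rewrite liftK.
have [c00|c0] := eqVneq (c ord0) 0.
  rewrite c00 scale0r add0r => ce0 i.
  by case: (unliftP ord0 i) => [j|] -> //; apply: (e_free _ ce0).
move=> /eqP; rewrite addr_eq0 => /eqP cx; case: nYx; rewrite eY.
exists (fun i => - ((c ord0)^-1 * c (lift ord0 i))).
apply: (scalerI c0); rewrite cx scaler_sumr -sumrN; apply: eq_bigr => i _.
by rewrite scalerA mulrN mulrA divff // mul1r scaleNr.
Qed.

Lemma invariant_eigenvector (C : numClosedFieldType) (V : lmodType C)
    (A : {linear V -> V}) (X : set V) (n : nat) :
  (0 < n)%N -> fin_dim X n -> A @` X `<=` X ->
  exists (l : C) (v : V), [/\ X v, v != 0 & A v = l *: v].
Proof.
move=> n_gt0 [e [e_free eX]] AX.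
have Ae i : lin_span e (A (e i)).
  by rewrite -eX; apply: AX; exists (e i) => //; rewrite eX; exact: lin_span_mem.
(* Row [i] of [N] holds the coordinates of [A (e i)], so a left eigenvector of [N] is the coordinate
   row of an eigenvector of [A]. *)
have [M eM] := choice Ae; pose N := \matrix_(i, j) M i j.
have [l /eigenvalueP[u uN u0]] := eigenvalue_closed N n_gt0.
exists l, (\sum_i u 0 i *: e i); split.
- by rewrite eX; exists (u 0).
- apply/contra_neq: u0 => /e_free ue; apply/rowP => i; rewrite mxE; exact: ue.
rewrite linear_sum scaler_sumr.
transitivity (\sum_i \sum_j (u 0 i * M i j) *: e j).
  apply: eq_bigr => i _; rewrite linearZ /= eM scaler_sumr.
  by apply: eq_bigr => j _; rewrite scalerA.
rewrite exchange_big; apply: eq_bigr => j _.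
rewrite scalerA -scaler_suml; congr (_ *: _).
have /rowP/(_ j) := uN; rewrite !mxE => <-.
by apply: eq_bigr => i _; rewrite mxE.
Qed.

(** * Orthogonal eigenbases of the plane [range T] *)

Lemma dot_sym0 (C : numClosedFieldType) (V : lmodType C)
    (ip : {dot V for @Num.conj C}) (x y : V) :
  ip x y = 0 -> ip y x = 0.
Proof. by move=> xy0; rewrite hermC /= xy0 rmorph0 mulr0. Qed.

Lemma orthogonal_lin_indep (C : numClosedFieldType) (V : lmodType C)
    (ip : {dot V for @Num.conj C}) (n : nat) (e : 'I_n -> V) :
  (forall i, e i != 0) -> (forall i j, i != j -> ip (e i) (e j) = 0) ->
  lin_indep e.
Proof.
move=> e_neq0 e_orth c c0 i.
have : ip (\sum_j c j *: e j) (e i) = 0 by rewrite c0 linear0l.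
rewrite linear_sumlz (bigD1 i) //= big1 ?addr0; last first.
  by move=> j ji; rewrite linearZl_LR /= e_orth // mulr0.
rewrite linearZl_LR => /eqP.
by rewrite mulf_eq0 dnorm_eq0 (negPf (e_neq0 i)) orbF => /eqP.
Qed.

Lemma real_conj (R : realType) (s : R) : Num.conj s%:C = s%:C.
Proof. by apply/conj_Creal; rewrite complex_real. Qed.

(** [T] is kept apart from [A] because frames of both operators are taken in the same plane, the
    range of their difference. The last clause says that the orthogonal complement of the plane lies
    in the kernel of [T]. *)
Definition eigenframe (R : realType) (H : completeNormedModType R[i])
    (ip : {dot H for (@Num.conj R[i])}) (T A : {linear H -> H})
    (l m : R[i]) (v w : H) : Prop :=
  [/\ v != 0 /\ w != 0, ip v w = 0, A v = l *: v /\ A w = m *: w,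
      range T = [set x | exists c d : R[i], x = c *: v + d *: w] &
      forall x, ip x v = 0 -> ip x w = 0 -> T x = 0].

Lemma eigenframeC (R : realType) (H : completeNormedModType R[i])
    (ip : {dot H for (@Num.conj R[i])}) (T A : {linear H -> H})
    (l m : R[i]) (v w : H) :
  eigenframe ip T A l m v w -> eigenframe ip T A m l w v.
Proof.
move=> [[v0 w0] vw [Av Aw] rT kT]; split=> //.
- exact: dot_sym0.
- by rewrite rT; apply/seteqP; split=> x [c [d ->]]; exists d, c; rewrite addrC.
- by move=> x xw xv; apply: kT.
Qed.

Lemma eigenframe_exists (R : realType) (H : completeNormedModType R[i])
    (ip : {dot H for (@Num.conj R[i])}) (T A : {linear H -> H}) :
  self_adjoint ip T -> self_adjoint ip A -> fin_dim (range T) 2 ->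
  Defs.invariant A (range T) ->
  exists (l m : R[i]) (v w : H), eigenframe ip T A l m v w.
Proof.
move=> saT saA dimT AT.
have [M0 Mlin] := fin_dim_subspace dimT.
have [l [v [Mv v0 Av]]] := invariant_eigenvector (ltn0Sn 1) dimT AT.
have [w [Mw w0 wv]] : exists w, [/\ range T w, w != 0 & ip w v = 0].
  have [e [e_free eM]] := dimT.
  pose e0 := e ord0; pose e1 := e (lift ord0 ord0).
  (* The coefficients are chosen so that the two terms of [ip w v] cancel. *)
  pose w := ip e1 v *: e0 - ip e0 v *: e1.
  exists w; split.
  - have Me i : range T (e i) by rewrite eM; exact: lin_span_mem.
    rewrite /w -scaleNr; apply: (Mlin); first exact: Me.
    by rewrite -[_ *: _]addr0; apply: (Mlin) => //; exact: Me.
  (* If [w] were 0, then [v] would be orthogonal to both basis vectors, hence to itself. *)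
  - apply/eqP => w0.
    have /e_free c0 :
        \sum_i (if i == ord0 then ip e1 v else - ip e0 v) *: e i = 0.
      by rewrite !big_ord_recl big_ord0 addr0 /= scaleNr.
    have e1v : ip e1 v = 0 := c0 ord0.
    have /eqP := c0 (lift ord0 ord0); rewrite /= oppr_eq0 => /eqP e0v.
    move: Mv; rewrite eM => -[c vE]; move: v0.
    rewrite -(dnorm_eq0 ip) {1}vE !big_ord_recl big_ord0 addr0 linearDl.
    by rewrite !linearZl_LR /= e0v e1v !mulr0 addr0 eqxx.
  - by rewrite linearBl !linearZl_LR /= mulrC subrr.
pose f (i : 'I_2) := if i == ord0 then v else w.
have vw := dot_sym0 wv.
have f_free : lin_indep f.
  apply: (orthogonal_lin_indep (ip := ip)); rewrite /f.
    by move=> i; case: ifP.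
  by move=> [[|[|//]] ?] [[|[|//]] ?].
have spanf : lin_span f = [set x | exists c d : R[i], x = c *: v + d *: w].
  apply/seteqP; split=> x.
    move=> [c ->]; exists (c ord0), (c (lift ord0 ord0)).
    by rewrite !big_ord_recl big_ord0 addr0.
  move=> [c [d ->]]; exists (fun i => if i == ord0 then c else d).
  by rewrite !big_ord_recl big_ord0 addr0.
have rT : range T = [set x | exists c d : R[i], x = c *: v + d *: w].
  rewrite -spanf; apply/esym/(fin_dim_subset_eq dimT); first by exists f.
  rewrite spanf => _ [c [d ->]]; apply: (Mlin) => //.
  by rewrite -[_ *: _]addr0; apply: (Mlin).
have [c [d Aw]] : exists c d : R[i], A w = c *: v + d *: w.
  suff : range T (A w) by rewrite rT.
  by apply: AT; exists w.
(* Self-adjointness makes [A w] orthogonal to [v], so [A w] has no component along [v]. *)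
have c0 : c = 0.
  have : ip (A w) v = 0 by rewrite saA Av linearZr_LR /= wv mulr0.
  rewrite Aw linearDl !linearZl_LR /= wv mulr0 addr0 => /eqP.
  by rewrite mulf_eq0 dnorm_eq0 (negPf v0) orbF => /eqP.
exists l, d, v, w; split=> //.
  by split=> //; rewrite Aw c0 scale0r add0r.
(* The square norm of [T x] is [ip x (T (T x))], and [T (T x)] is a combination of [v] and [w]. *)
move=> x xv xw; apply/eqP; rewrite -(dnorm_eq0 ip) saT.
have : range T (T (T x)) by exists (T x).
rewrite rT => -[p [q ->]].
by rewrite linearDr !linearZr_LR /= xv xw !mulr0 addr0.
Qed.

(** * Kernels, eigenvalues and eigenspaces of operators *)

Lemma range_self_adjoint_ker (R : realType) (H : completeNormedModType R[i])
    (ip : {dot H for (@Num.conj R[i])}) (T : {linear H -> H}) (x : H) :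
  self_adjoint ip T -> range T x -> T x = 0 -> x = 0.
Proof.
move=> saT [y _ <-] TTy0; apply/eqP.
by rewrite -(dnorm_eq0 ip) saT TTy0 linear0r.
Qed.

Lemma self_adjoint_eigen_orthogonal (R : realType)
    (H : completeNormedModType R[i]) (ip : {dot H for (@Num.conj R[i])})
    (A : {linear H -> H}) (s t : R) (x y : H) :
  self_adjoint ip A -> s != t -> A x = s%:C *: x -> A y = t%:C *: y ->
  ip x y = 0.
Proof.
move=> saA st Ax Ay; have := saA x y.
rewrite Ax Ay linearZl_LR linearZr_LR /= real_conj => /eqP.
rewrite -subr_eq0 -mulrBl mulf_eq0 subr_eq0 => /orP[/eqP /complexI /eqP|/eqP //].
by rewrite (negPf st).
Qed.

Lemma eigenvalue_in_spectrum (R : realType) (H : completeNormedModType R[i])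
    (A : {linear H -> H}) (l : R[i]) (v : H) :
  v != 0 -> A v = l *: v -> spectrum A l.
Proof.
move=> /eqP v0 Av [S [_ SA _]]; apply: v0.
by rewrite -(SA v) Av subrr linear0.
Qed.

Lemma eigenspace_subspace (R : realType) (H : completeNormedModType R[i])
    (A : {linear H -> H}) (s : R) :
  Defs.subspace (eigenspace_of A s).
Proof.
split=> [|c x y Ax Ay]; rewrite /eigenspace_of /=; first by rewrite linear0 scaler0.
by rewrite linearP Ax Ay scalerDr !scalerA mulrC.
Qed.

Lemma eigenspace_closed (R : realType) (H : completeNormedModType R[i])
    (A : {linear H -> H}) (s : R) :
  continuous A -> closed (eigenspace_of A s).
Proof.
move=> cA.
have -> : eigenspace_of A s = (fun x => A x - s%:C *: x) @^-1` [set 0].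
  apply/seteqP; split=> x; rewrite /eigenspace_of /= => /eqP.
    by rewrite -subr_eq0 => /eqP.
  by rewrite subr_eq0 => /eqP.
suff cB : continuous (fun x => A x - s%:C *: x).
  apply: ((continuous_closedP _).1 cB).
  exact/accessible_closed_set1/hausdorff_accessible/norm_hausdorff.
move=> x; apply: cvgB; first exact: cA.
by apply: cvgZ; [exact: cvg_cst | exact: cvg_id].
Qed.

(** * Comparison of two operators that agree exactly on the kernel of [T] *)

Lemma eigenframe_eigenspace_ker (R : realType)
    (H : completeNormedModType R[i]) (ip : {dot H for (@Num.conj R[i])})
    (T A : {linear H -> H}) (r s t : R) (v w x : H) :
  self_adjoint ip A -> eigenframe ip T A s%:C t%:C v w ->
  r != s -> r != t -> eigenspace_of A r x -> T x = 0.
Proof.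
move=> saA [_ _ [Av Aw] _ kT] rs rt Ax.
by apply: kT; [exact: (self_adjoint_eigen_orthogonal saA rs)
             | exact: (self_adjoint_eigen_orthogonal saA rt)].
Qed.

Lemma eigenframe_range (R : realType) (H : completeNormedModType R[i])
    (ip : {dot H for (@Num.conj R[i])}) (T A : {linear H -> H})
    (l m : R[i]) (v w : H) :
  eigenframe ip T A l m v w -> range T v.
Proof.
by move=> [_ _ _ -> _]; exists 1, 0; rewrite scale1r scale0r addr0.
Qed.

Lemma eigenframe_scalar (R : realType) (H : completeNormedModType R[i])
    (ip : {dot H for (@Num.conj R[i])}) (T A : {linear H -> H})
    (l : R[i]) (v w x : H) :
  eigenframe ip T A l l v w -> range T x -> A x = l *: x.
Proof.
move=> [_ _ [Av Aw] -> _] [c [d ->]].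
by rewrite linearD !linearZ /= Av Aw scalerDr !scalerA ![l * _]mulrC.
Qed.

(** If [m] were [l], then [A] and [B] would agree at [v'], a nonzero vector of the range of [T],
    where [T] is injective. The only link between [T] and the operators is that [T] vanishes exactly
    where they agree, so [A] and [B] can be swapped with [T] unchanged. *)
Lemma eigenframe_scalar_neq (R : realType) (H : completeNormedModType R[i])
    (ip : {dot H for (@Num.conj R[i])}) (T A B : {linear H -> H})
    (l m n : R[i]) (v w v' w' : H) :
  self_adjoint ip T -> (forall x, T x = 0 <-> A x = B x) ->
  eigenframe ip T A l l v w -> eigenframe ip T B m n v' w' -> m != l.
Proof.
move=> saT TAB frA frB; have rv' := eigenframe_range frB.
have [[v'0 _] _ [Bv' _] _ _] := frB.
apply: contra_neq v'0 => ml; apply: (range_self_adjoint_ker saT) => //.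
by apply/TAB; rewrite Bv' ml; exact: eigenframe_scalar frA rv'.
Qed.

(** Otherwise the [s]-eigenspace of [B] lies in the kernel of [T], hence in that of [A]. Equal
    finite dimensions make the two eigenspaces equal, and [v] falls in both the kernel and the range
    of [T]. *)
Lemma eigenframe_transfer (R : realType) (H : completeNormedModType R[i])
    (ip : {dot H for (@Num.conj R[i])}) (T A B : {linear H -> H})
    (s t s' t' : R) (v w v' w' : H) (n : nat) :
  self_adjoint ip T -> self_adjoint ip B ->
  (forall x, T x = 0 <-> A x = B x) ->
  eigenframe ip T A s%:C t%:C v w ->
  eigenframe ip T B s'%:C t'%:C v' w' ->
  fin_dim (eigenspace_of A s) n -> fin_dim (eigenspace_of B s) n ->
  s = s' \/ s = t'.
Proof.
move=> saT saB TAB frA frB dimA dimB.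
have [|ss'] := eqVneq s s'; first by left.
have [|st'] := eqVneq s t'; first by right.
have ker x : eigenspace_of B s x -> T x = 0.
  exact: (eigenframe_eigenspace_ker saB frB).
have BA : eigenspace_of B s = eigenspace_of A s.
  apply: fin_dim_subset_eq dimA dimB _ => x Bx.
  by rewrite /eigenspace_of /= ((TAB x).1 (ker x Bx)).
have [[/eqP v0 _] _ [Av _] _ _] := frA; case: v0.
apply: (range_self_adjoint_ker saT).
  exact: eigenframe_range frA.
by apply: ker; rewrite BA.
Qed.

Lemma eigenframe_hyperplane (R : realType) (H : completeNormedModType R[i])
    (ip : {dot H for (@Num.conj R[i])}) (T A B : {linear H -> H})
    (s t : R) (v w : H) :
  self_adjoint ip T -> self_adjoint ip A ->
  (forall x, T x = 0 <-> A x = B x) ->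
  eigenframe ip T A s%:C t%:C v w -> s != t ->
  hyperplane_in (eigenspace_of A s `&` eigenspace_of B s) (eigenspace_of A s).
Proof.
move=> saT saA TAB frA st.
have [[v0 w0] vw [Av Aw] rT kT] := frA.
have [A0 Alin] := eigenspace_subspace A s.
have [B0 Blin] := eigenspace_subspace B s.
split=> [|x []//|].
  split=> // c x y [Ax Bx] [Ay By]; split; [exact: Alin|exact: Blin].
exists v.
  split=> // -[_ Bv]; move/eqP: v0; apply.
  apply: (range_self_adjoint_ker saT).
    exact: eigenframe_range frA.
  by apply/TAB; rewrite Av Bv.
(* Removing the projection of [x] on [v] leaves a vector [z] of the [s]-eigenspace orthogonal to
   [v], and to [w] because [s] and [t] differ. So [T z = 0] and [B] agrees with [A] at [z]. *)
move=> x Ax; pose c := ip x v / ip v v; pose z := x - c *: v.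
exists z; last by exists c; rewrite subrK.
have Az : eigenspace_of A s z.
  by rewrite /z addrC -scaleNr; apply: Alin.
split=> //; rewrite /eigenspace_of /= -((TAB z).1 _) //; apply: kT.
  by rewrite linearBl linearZl_LR /= divfK ?dnorm_eq0 // subrr.
exact: (self_adjoint_eigen_orthogonal saA st).
Qed.

(** * Matching the eigenvalue indices of the two frames *)

Lemma eigenframe_in_grassmannian (R : realType) (H : completeNormedModType R[i])
    (ip : {dot H for (@Num.conj R[i])}) (k : nat) (a : 'I_k -> R)
    (d : 'I_k -> natbar) (T A : {linear H -> H}) :
  self_adjoint ip T -> fin_dim (range T) 2 -> Defs.invariant A (range T) ->
  grassmannian ip a d A ->
  exists (i j : 'I_k) (v w : H), eigenframe ip T A (a i)%:C (a j)%:C v w.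
Proof.
move=> saT dimT AT [_ _ saA spA _].
have [l [m [v [w fr]]]] := eigenframe_exists saT saA dimT AT.
have [[v0 w0] _ [Av Aw] _ _] := fr.
have := eigenvalue_in_spectrum v0 Av; rewrite spA => -[i _ il].
have := eigenvalue_in_spectrum w0 Aw; rewrite spA => -[j _ jm].
by exists i, j, v, w; rewrite il jm.
Qed.

Lemma eigenframe_index_mem (R : realType) (H : completeNormedModType R[i])
    (ip : {dot H for (@Num.conj R[i])}) (k : nat) (a : 'I_k -> R)
    (d : 'I_k -> natbar) (T A B : {linear H -> H}) (i j i' j' : 'I_k)
    (v w v' w' : H) :
  injective a -> self_adjoint ip T -> (forall x, T x = 0 <-> A x = B x) ->
  grassmannian ip a d A -> grassmannian ip a d B ->
  eigenframe ip T A (a i)%:C (a j)%:C v w ->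
  eigenframe ip T B (a i')%:C (a j')%:C v' w' ->
  d i != None -> i = i' \/ i = j'.
Proof.
move=> a_inj saT TAB [_ _ saA _ dA] [_ _ saB _ dB] frA frB.
case di : (d i) => [n|//] _.
have := dA i; have := dB i; rewrite di => dimB dimA.
by case: (eigenframe_transfer saT saB TAB frA frB dimA dimB) => /a_inj;
  [left | right].
Qed.

Lemma eigenframes_subspace_adjacent (R : realType)
    (H : completeNormedModType R[i]) (ip : {dot H for (@Num.conj R[i])})
    (T A B : {linear H -> H}) (s t : R) (v w v' w' : H) (n : natbar) :
  continuous A -> continuous B -> self_adjoint ip T -> self_adjoint ip A ->
  self_adjoint ip B -> (forall x, T x = 0 <-> A x = B x) ->
  has_dim (eigenspace_of A s) n -> has_dim (eigenspace_of B s) n -> s != t ->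
  eigenframe ip T A s%:C t%:C v w -> eigenframe ip T B s%:C t%:C v' w' ->
  subspace_adjacent (eigenspace_of A s) (eigenspace_of B s).
Proof.
move=> cA cB saT saA saB TAB dimA dimB st frA frB; split.
- by split; [exact: eigenspace_subspace | exact: eigenspace_closed].
- by split; [exact: eigenspace_subspace | exact: eigenspace_closed].
- by exists n.
- exact: (eigenframe_hyperplane saT saA TAB frA st).
have TBA x : T x = 0 <-> B x = A x.
  by rewrite TAB; split=> ->.
by rewrite setIC; exact: (eigenframe_hyperplane saT saB TBA frB st).
Qed.

Lemma eigenframes_ij_adjacent (R : realType) (H : completeNormedModType R[i])
    (ip : {dot H for (@Num.conj R[i])}) (k : nat) (a : 'I_k -> R)
    (d : 'I_k -> natbar) (T A B : {linear H -> H}) (i j : 'I_k)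
    (v w v' w' : H) :
  injective a -> self_adjoint ip T -> (forall x, T x = 0 <-> A x = B x) ->
  grassmannian ip a d A -> grassmannian ip a d B -> i != j ->
  eigenframe ip T A (a i)%:C (a j)%:C v w ->
  eigenframe ip T B (a i)%:C (a j)%:C v' w' -> ij_adjacent a i j A B.
Proof.
move=> a_inj saT TAB [cA _ saA _ dA] [cB _ saB _ dB] ij frA frB.
have aij : a i != a j by rewrite inj_eq.
split=> t; rewrite !inE.
  case/orP=> /eqP ->.
    exact: (eigenframes_subspace_adjacent cA cB saT saA saB TAB
              (dA i) (dB i) aij frA frB).
  rewrite eq_sym in aij.
  exact: (eigenframes_subspace_adjacent cA cB saT saA saB TAB
            (dA j) (dB j) aij (eigenframeC frA) (eigenframeC frB)).
rewrite negb_or => /andP[ti tj].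
have ati : a t != a i by rewrite inj_eq.
have atj : a t != a j by rewrite inj_eq.
(* For the remaining indices both eigenspaces lie in the kernel of [T], where [A] and [B] agree. *)
apply/seteqP; split=> x Xx.
  have /TAB AB := eigenframe_eigenspace_ker saA frA ati atj Xx.
  by rewrite /eigenspace_of /= -AB.
have /TAB AB := eigenframe_eigenspace_ker saB frB ati atj Xx.
by rewrite /eigenspace_of /= AB.
Qed.

(** If [i = j], then [A] is scalar on the plane and [a i] is not an eigenvalue of [B] there.
    Transfer in both directions then makes [d i] and [d i'] infinite, so [a i] and [a i'] are both
    0, against [i != i']. *)
Lemma eigenframe_index_neq (R : realType) (H : completeNormedModType R[i])
    (ip : {dot H for (@Num.conj R[i])}) (k : nat) (a : 'I_k -> R)
    (d : 'I_k -> natbar) (T A B : {linear H -> H}) (i j i' j' : 'I_k)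
    (v w v' w' : H) :
  injective a -> (forall i, d i = None -> a i = 0) -> self_adjoint ip T ->
  (forall x, T x = 0 <-> A x = B x) ->
  grassmannian ip a d A -> grassmannian ip a d B ->
  eigenframe ip T A (a i)%:C (a j)%:C v w ->
  eigenframe ip T B (a i')%:C (a j')%:C v' w' -> i != j.
Proof.
move=> a_inj d_oo saT TAB GA GB frA frB; apply/eqP => ij; rewrite -{}ij in frA.
have TBA x : T x = 0 <-> B x = A x by rewrite TAB; split=> ->.
have neq p q x y : eigenframe ip T B (a p)%:C (a q)%:C x y -> p != i.
  move=> /(eigenframe_scalar_neq saT TAB frA).
  by apply: contra_neq => ->.
have ii' := neq _ _ _ _ frB; have ij' := neq _ _ _ _ (eigenframeC frB).
have mi := eigenframe_index_mem a_inj saT TAB GA GB frA frB.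
have mi' := eigenframe_index_mem a_inj saT TBA GB GA frB frA.
have [/eqP di|/mi] := boolP (d i == None); last first.
  by move=> [|] /eqP; rewrite eq_sym ?(negPf ii') ?(negPf ij').
have [/eqP di'|/mi'] := boolP (d i' == None); last first.
  by move=> [|] /eqP; rewrite (negPf ii').
by move/eqP: ii'; apply; apply: a_inj; rewrite (d_oo _ di) (d_oo _ di').
Qed.

(** Once one index is common, so is the other: a finite [d j] or [d j'] lets its eigenvalue
    transfer, and it cannot transfer to [i]. If both are infinite, [a j] and [a j'] are 0. *)
Lemma eigenframes_shared_ij_adjacent (R : realType)
    (H : completeNormedModType R[i]) (ip : {dot H for (@Num.conj R[i])})
    (k : nat) (a : 'I_k -> R) (d : 'I_k -> natbar) (T A B : {linear H -> H})
    (i j j' : 'I_k) (v w v' w' : H) :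
  injective a -> (forall i, d i = None -> a i = 0) -> self_adjoint ip T ->
  (forall x, T x = 0 <-> A x = B x) ->
  grassmannian ip a d A -> grassmannian ip a d B ->
  eigenframe ip T A (a i)%:C (a j)%:C v w ->
  eigenframe ip T B (a i)%:C (a j')%:C v' w' ->
  i != j /\ ij_adjacent a i j A B.
Proof.
move=> a_inj d_oo saT TAB GA GB frA frB.
have TBA x : T x = 0 <-> B x = A x by rewrite TAB; split=> ->.
have ij := eigenframe_index_neq a_inj d_oo saT TAB GA GB frA frB.
have ij' := eigenframe_index_neq a_inj d_oo saT TBA GB GA frB frA.
suff jj' : j' = j.
  rewrite jj' in frB; split=> //.
  exact: (eigenframes_ij_adjacent a_inj saT TAB GA GB ij frA frB).
have [/eqP dj|] := boolP (d j == None); last first.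
  have frA' := eigenframeC frA.
  case/(eigenframe_index_mem a_inj saT TAB GA GB frA' frB) => [/eqP|//].
  by rewrite eq_sym (negPf ij).
have [/eqP dj'|] := boolP (d j' == None).
  by apply: a_inj; rewrite (d_oo _ dj) (d_oo _ dj').
have frB' := eigenframeC frB.
case/(eigenframe_index_mem a_inj saT TBA GB GA frB' frA) => [/eqP|//].
by rewrite eq_sym (negPf ij').
Qed.

Theorem theorem2 (R : realType) (H : completeNormedModType R[i])
    (ip : {dot H for (@Num.conj R[i])}) (Hip : norm_from_inner ip)
    (k : nat) (k_ge2 : (2 <= k)%N)
    (a : 'I_k -> R) (a_inj : injective a)
    (d : 'I_k -> natbar) (d_gt0 : forall i, d i <> Some 0%N)
    (d_oo : forall i, d i = None -> a i = 0)
    (dimH : has_dim [set: H] (\big[add_natbar/Some 0%N]_(i < k) d i))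
    (A B : {linear H -> H})
    (GA : grassmannian ip a d A) (GB : grassmannian ip a d B)
    (AB_adj : op_adjacent A B) :
  exists i j : 'I_k, i != j /\ ij_adjacent a i j A B.
Proof.
pose T : {linear H -> H} := B \- A.
have [dimT [AT BT _ _]] := AB_adj.
have saT : self_adjoint ip T.
  have [[_ _ saA _ _] [_ _ saB _ _]] := (GA, GB).
  move=> x y; transitivity (ip (B x) y - ip (A x) y); first exact: linearBl.
  by rewrite saA saB; exact/esym/linearBr.
have TAB x : T x = 0 <-> A x = B x.
  rewrite /T /=; split=> [/eqP|->]; last by rewrite subrr.
  by rewrite subr_eq0 => /eqP.
have [i [j [v [w frA]]]] := eigenframe_in_grassmannian saT dimT AT GA.
have [i' [j' [v' [w' frB]]]] := eigenframe_in_grassmannian saT dimT BT GB.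
have ij := eigenframe_index_neq a_inj d_oo saT TAB GA GB frA frB.
have shared :=
  eigenframes_shared_ij_adjacent a_inj d_oo saT TAB GA GB.
(* A common index comes from a finite multiplicity. If [d i] is infinite, then [d j] is finite,
   since [a] takes the value 0 at most once, and [j] plays the part of [i]. *)
have [/eqP di|] := boolP (d i == None).
  have : d j != None.
    apply: contra_neq ij => dj.
    by apply: a_inj; rewrite (d_oo _ di) (d_oo _ dj).
  case/(eigenframe_index_mem a_inj saT TAB GA GB (eigenframeC frA) frB) => e.
    rewrite -e in frB; exists j, i.
    exact: (shared _ _ _ _ _ _ _ (eigenframeC frA) frB).
  rewrite -e in frB; exists j, i.
  exact: (shared _ _ _ _ _ _ _ (eigenframeC frA) (eigenframeC frB)).
case/(eigenframe_index_mem a_inj saT TAB GA GB frA frB) => e.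
  by rewrite -e in frB; exists i, j; exact: (shared _ _ _ _ _ _ _ frA frB).
rewrite -e in frB; exists i, j.
exact: (shared _ _ _ _ _ _ _ frA (eigenframeC frB)).
Qed.
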